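(* Let $A$ be an algebra in a monoidal category $\mathcal{M}$. The following assertions are equivalent: (a) $A$ is separable in $\mathcal{M}$. (b) The forgetful functor ${}_{A}\mathbb{H}_{A}:{}_{A}\mathcal{M}_{A}\to\mathcal{M}$ is separable. (c) Every $A$-bimodule (in $\mathcal{M}$) is ${}_{A}\mathcal{E}_{A}$-projective. (d) The $A$-bimodule $A$ is ${}_{A}\mathcal{E}_{A}$-projective.
   Context: Monoidal categories are assumed strict. ${}_A\mathcal{M}_A$ is the category of $A$-bimodules in $\mathcal{M}$. The algebra $(A,m,u)$ is separable in $\mathcal{M}$ if $m:A\otimes A\to A$ has a section $A\to A\otimes A$ in ${}_A\mathcal{M}_A$. ${}_A\mathcal{E}_A$ is the class of morphisms in ${}_A\mathcal{M}_A$ that have a section (right inverse) in $\mathcal{M}$. An object $P$ of ${}_A\mathcal{M}_A$ is ${}_A\mathcal{E}_A$-projective if for every $f:X\to Y$ in ${}_A\mathcal{E}_A$ every morphism $P\to Y$ in ${}_A\mathcal{M}_A$ factors through $f$. Separable functor: a functor $U:\mathfrak{B}\to\mathfrak{A}$ such that the natural transformation $\mathrm{Hom}_{\mathfrak B}(\bullet,\bullet)\to \mathrm{Hom}_{\mathfrak A}(U(\bullet),U(\bullet))$, $f\mapsto U(f)$, of functors $\mathfrak{B}^{op}\times\mathfrak{B}\to\mathfrak{Sets}$ has a left inverse natural transformation. *)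

(* Defs.v *)
From Corelib Require Import ssreflect.
From Stdlib Require Import ProofIrrelevance.
Set Implicit Arguments.
Unset Strict Implicit.
Unset Printing Implicit Defensive.

Declare Scope cat_scope.
Local Open Scope cat_scope.

Record category := Category {
  ob :> Type;
  hom : ob -> ob -> Type;
  idm : forall X : ob, hom X X;
  comp : forall X Y Z : ob, hom Y Z -> hom X Y -> hom X Z;
  compA : forall (W X Y Z : ob) (h : hom Y Z) (g : hom X Y) (f : hom W X),
    comp h (comp g f) = comp (comp h g) f;
  comp1m : forall (X Y : ob) (f : hom X Y), comp (idm Y) f = f;
  compm1 : forall (X Y : ob) (f : hom X Y), comp f (idm X) = f
}.
Arguments hom {c} X Y.
Arguments idm {c} X.
Arguments comp {c X Y Z} g f.

Notation "g ∘ f" := (comp g f) (at level 40, left associativity) : cat_scope.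

Record functor (C D : category) := Functor {
  fob :> C -> D;
  fmap : forall X Y : C, hom X Y -> hom (fob X) (fob Y);
  fmap1 : forall X : C, fmap (idm X) = idm (fob X);
  fmapM : forall (X Y Z : C) (g : hom Y Z) (f : hom X Y),
    fmap (g ∘ f) = fmap g ∘ fmap f
}.
Arguments fmap {C D} U {X Y} f : rename.

Definition has_section (C : category) (X Y : C) (f : hom X Y) : Prop :=
  exists s : hom Y X, f ∘ s = idm Y.

(** [P X Y] is the component at [(X, Y)] of a transformation
    Hom_A(U -, U -) -> Hom_B(-, -) of functors B^op x B -> Sets; the first
    conjunct is its naturality in both variables, the second says that it is
    left inverse to [f |-> U f]. *)
Definition separable_functor (B A : category) (U : functor B A) : Prop :=
  exists P : forall X Y : B, hom (U X) (U Y) -> hom X Y,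
    (forall (X X' Y Y' : B) (f : hom X' X) (g : hom Y Y') (h : hom (U X) (U Y)),
        P X' Y' (fmap U g ∘ h ∘ fmap U f) = g ∘ P X Y h ∘ f)
    /\ (forall (X Y : B) (f : hom X Y), P X Y (fmap U f) = f).

Definition projective (C : category)
    (E : forall X Y : C, hom X Y -> Prop) (P : C) : Prop :=
  forall (X Y : C) (f : hom X Y), E X Y f ->
  forall g : hom P Y, exists h : hom P X, f ∘ h = g.

Record monoidal_category := MonoidalCategory {
  mcat :> category;
  tens : mcat -> mcat -> mcat;
  tensm : forall X X' Y Y' : mcat,
    hom X X' -> hom Y Y' -> hom (tens X Y) (tens X' Y');
  tensm1 : forall X Y : mcat, tensm (idm X) (idm Y) = idm (tens X Y);
  tensmM : forall (X X' X'' Y Y' Y'' : mcat)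
      (f' : hom X' X'') (f : hom X X') (g' : hom Y' Y'') (g : hom Y Y'),
    tensm (f' ∘ f) (g' ∘ g) = tensm f' g' ∘ tensm f g;
  munit : mcat;
  assoc : forall X Y Z : mcat, hom (tens (tens X Y) Z) (tens X (tens Y Z));
  assocV : forall X Y Z : mcat, hom (tens X (tens Y Z)) (tens (tens X Y) Z);
  assocK : forall X Y Z : mcat, assocV X Y Z ∘ assoc X Y Z = idm _;
  assocVK : forall X Y Z : mcat, assoc X Y Z ∘ assocV X Y Z = idm _;
  assoc_nat : forall (X X' Y Y' Z Z' : mcat)
      (f : hom X X') (g : hom Y Y') (h : hom Z Z'),
    assoc X' Y' Z' ∘ tensm (tensm f g) h = tensm f (tensm g h) ∘ assoc X Y Z;
  lunit : forall X : mcat, hom (tens munit X) X;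
  lunitV : forall X : mcat, hom X (tens munit X);
  lunitK : forall X : mcat, lunitV X ∘ lunit X = idm _;
  lunitVK : forall X : mcat, lunit X ∘ lunitV X = idm _;
  lunit_nat : forall (X Y : mcat) (f : hom X Y),
    lunit Y ∘ tensm (idm munit) f = f ∘ lunit X;
  runit : forall X : mcat, hom (tens X munit) X;
  runitV : forall X : mcat, hom X (tens X munit);
  runitK : forall X : mcat, runitV X ∘ runit X = idm _;
  runitVK : forall X : mcat, runit X ∘ runitV X = idm _;
  runit_nat : forall (X Y : mcat) (f : hom X Y),
    runit Y ∘ tensm f (idm munit) = f ∘ runit X;
  triangle : forall X Y : mcat,
    tensm (idm X) (lunit Y) ∘ assoc X munit Y = tensm (runit X) (idm Y);
  pentagon : forall W X Y Z : mcat,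
    tensm (idm W) (assoc X Y Z) ∘ assoc W (tens X Y) Z
      ∘ tensm (assoc W X Y) (idm Z)
    = assoc W X (tens Y Z) ∘ assoc (tens W X) Y Z
}.
Arguments tens {m} X Y.
Arguments tensm {m X X' Y Y'} f g.
Arguments munit {m}.
Arguments assoc {m} X Y Z.
Arguments assocV {m} X Y Z.
Arguments lunit {m} X.
Arguments lunitV {m} X.
Arguments runit {m} X.
Arguments runitV {m} X.

Notation "X ⊗ Y" := (tens X Y) (at level 38, left associativity) : cat_scope.
Notation "f ⊠ g" := (tensm f g) (at level 38, left associativity) : cat_scope.

Definition hom_of_eq (C : category) (X Y : C) (e : X = Y) : hom X Y :=
  match e in _ = Z return hom X Z with eq_refl => idm X end.

(** The tensor product is associative and unital on the nose, and the
    structural isomorphisms are identities (transported along the equalities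
    of objects, since these are only propositional). *)
Definition strict (M : monoidal_category) : Prop :=
  (forall X Y Z : M, exists e : (X ⊗ Y) ⊗ Z = X ⊗ (Y ⊗ Z),
      assoc X Y Z = hom_of_eq e)
  /\ (forall X : M, exists e : munit ⊗ X = X, lunit X = hom_of_eq e)
  /\ (forall X : M, exists e : X ⊗ munit = X, runit X = hom_of_eq e).

Record algebra (M : monoidal_category) := Algebra {
  aob :> M;
  amul : hom (aob ⊗ aob) aob;
  aunit : hom munit aob;
  amulA : amul ∘ (amul ⊠ idm aob) = amul ∘ (idm aob ⊠ amul) ∘ assoc aob aob aob;
  amul1m : amul ∘ (aunit ⊠ idm aob) = lunit aob;
  amulm1 : amul ∘ (idm aob ⊠ aunit) = runit aob
}.
Arguments amul {M} A : rename.
Arguments aunit {M} A : rename.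

Section Bimodules.

Variables (M : monoidal_category) (A : algebra M).

Record bimodule := Bimodule {
  bob :> M;
  lact : hom (A ⊗ bob) bob;
  ract : hom (bob ⊗ A) bob;
  lactA : lact ∘ (amul A ⊠ idm bob) = lact ∘ (idm A ⊠ lact) ∘ assoc A A bob;
  lact1 : lact ∘ (aunit A ⊠ idm bob) = lunit bob;
  ractA : ract ∘ (ract ⊠ idm A) = ract ∘ (idm bob ⊠ amul A) ∘ assoc bob A A;
  ract1 : ract ∘ (idm bob ⊠ aunit A) = runit bob;
  lractA : ract ∘ (lact ⊠ idm A) = lact ∘ (idm A ⊠ ract) ∘ assoc A bob A
}.

Record bimodule_hom (X Y : bimodule) := BimoduleHom {
  bmap :> hom (bob X) (bob Y);
  bmap_lact : bmap ∘ lact X = lact Y ∘ (idm A ⊠ bmap);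
  bmap_ract : bmap ∘ ract X = ract Y ∘ (bmap ⊠ idm A)
}.

Lemma bimodule_hom_eq (X Y : bimodule) (f g : bimodule_hom X Y) :
  bmap f = bmap g -> f = g.
Proof.
case: f g => f lf rf [g lg rg] /= E; subst g.
by rewrite (proof_irrelevance _ lf lg) (proof_irrelevance _ rf rg).
Qed.

Lemma bimodule_id_lact (X : bimodule) :
  idm X ∘ lact X = lact X ∘ (idm A ⊠ idm X).
Proof. by rewrite tensm1 comp1m compm1. Qed.

Lemma bimodule_id_ract (X : bimodule) :
  idm X ∘ ract X = ract X ∘ (idm X ⊠ idm A).
Proof. by rewrite tensm1 comp1m compm1. Qed.

Definition bimodule_id (X : bimodule) : bimodule_hom X X :=
  BimoduleHom (bimodule_id_lact X) (bimodule_id_ract X).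

Lemma bimodule_comp_lact (X Y Z : bimodule)
    (g : bimodule_hom Y Z) (f : bimodule_hom X Y) :
  (g ∘ f) ∘ lact X = lact Z ∘ (idm A ⊠ (g ∘ f)).
Proof.
rewrite -compA bmap_lact compA bmap_lact -compA -tensmM.
by rewrite comp1m.
Qed.

Lemma bimodule_comp_ract (X Y Z : bimodule)
    (g : bimodule_hom Y Z) (f : bimodule_hom X Y) :
  (g ∘ f) ∘ ract X = ract Z ∘ ((g ∘ f) ⊠ idm A).
Proof.
rewrite -compA bmap_ract compA bmap_ract -compA -tensmM.
by rewrite comp1m.
Qed.

Definition bimodule_comp (X Y Z : bimodule)
    (g : bimodule_hom Y Z) (f : bimodule_hom X Y) : bimodule_hom X Z :=
  BimoduleHom (bimodule_comp_lact g f) (bimodule_comp_ract g f).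

Definition bimodules : category.
Proof.
refine (@Category bimodule bimodule_hom bimodule_id bimodule_comp _ _ _).
- by move=> W X Y Z h g f; apply: bimodule_hom_eq; apply: compA.
- by move=> X Y f; apply: bimodule_hom_eq; apply: comp1m.
- by move=> X Y f; apply: bimodule_hom_eq; apply: compm1.
Defined.

Definition forgetful : functor bimodules M :=
  @Functor bimodules M bob bmap (fun _ => eq_refl) (fun _ _ _ _ _ => eq_refl).

Definition split_in_base (X Y : bimodules) (f : hom X Y) : Prop :=
  has_section (fmap forgetful f).

Definition regular_bimodule : bimodules :=
  @Bimodule A (amul A) (amul A)
    (amulA A) (amul1m A) (amulA A) (amulm1 A) (amulA A).

End Bimodules.

Section Coherence.

Variable M : monoidal_category.
Implicit Types W X Y Z : M.

Lemma tensm_compl X X' X'' Y (f' : hom X' X'') (f : hom X X') :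
  (f' ∘ f) ⊠ idm Y = (f' ⊠ idm Y) ∘ (f ⊠ idm Y).
Proof. by rewrite -tensmM comp1m. Qed.

Lemma tensm_compr X X' X'' Y (f' : hom X' X'') (f : hom X X') :
  idm Y ⊠ (f' ∘ f) = (idm Y ⊠ f') ∘ (idm Y ⊠ f).
Proof. by rewrite -tensmM comp1m. Qed.

Lemma assocV_nat X X' Y Y' Z Z' (f : hom X X') (g : hom Y Y') (h : hom Z Z') :
  assocV X' Y' Z' ∘ (f ⊠ (g ⊠ h)) = ((f ⊠ g) ⊠ h) ∘ assocV X Y Z.
Proof.
rewrite -[LHS]compm1 -(assocVK X Y Z) compA -[X in X ∘ _]compA -assoc_nat.
by rewrite compA assocK comp1m.
Qed.

Lemma assoc_epi X Y Z W (f g : hom (X ⊗ (Y ⊗ Z)) W) :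
  f ∘ assoc X Y Z = g ∘ assoc X Y Z -> f = g.
Proof.
by move=> /(f_equal (fun k => k ∘ assocV X Y Z)); rewrite -!compA assocVK !compm1.
Qed.

Lemma assoc_mono X Y Z W (f g : hom W ((X ⊗ Y) ⊗ Z)) :
  assoc X Y Z ∘ f = assoc X Y Z ∘ g -> f = g.
Proof.
by move=> /(f_equal (fun k => assocV X Y Z ∘ k)); rewrite !compA assocK !comp1m.
Qed.

Lemma lunit_inj X Y (f g : hom X Y) :
  idm munit ⊠ f = idm munit ⊠ g -> f = g.
Proof.
move=> E; rewrite -[f]compm1 -[g]compm1 -(lunitVK X) !compA.
by rewrite -!lunit_nat E.
Qed.

Lemma runit_inj X Y (f g : hom X Y) :
  f ⊠ idm munit = g ⊠ idm munit -> f = g.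
Proof.
move=> E; rewrite -[f]compm1 -[g]compm1 -(runitVK X) !compA.
by rewrite -!runit_nat E.
Qed.

Lemma lunit_assoc X Y :
  lunit (X ⊗ Y) ∘ assoc munit X Y = lunit X ⊠ idm Y.
Proof.
apply: lunit_inj; apply: assoc_epi.
have E (f g : hom ((munit ⊗ (munit ⊗ X)) ⊗ Y) (munit ⊗ (X ⊗ Y))) :
    f ∘ (assoc munit munit X ⊠ idm Y) = g ∘ (assoc munit munit X ⊠ idm Y) -> f = g.
  move=> /(f_equal (fun k => k ∘ (assocV munit munit X ⊠ idm Y))).
  by rewrite -!compA -tensm_compl assocVK tensm1 !compm1.
apply: E.
rewrite tensm_compr -!(compA (idm munit ⊠ lunit _)) pentagon compA triangle.
rewrite -(tensm1 X Y) -assoc_nat -(triangle munit X) tensm_compl.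
by rewrite compA assoc_nat.
Qed.

Lemma runit_assoc X Y :
  (idm X ⊠ runit Y) ∘ assoc X Y munit = runit (X ⊗ Y).
Proof.
apply: runit_inj; apply: assoc_mono.
rewrite tensm_compl compA assoc_nat -(triangle Y munit) tensm_compr.
rewrite -!(compA (idm X ⊠ (idm Y ⊠ lunit _))) pentagon compA -assoc_nat tensm1.
by rewrite -compA triangle.
Qed.

Lemma pentagonV W X Y Z :
  (assoc W X Y ⊠ idm Z) ∘ assocV (W ⊗ X) Y Z
  = assocV W (X ⊗ Y) Z ∘ (idm W ⊠ assocV X Y Z) ∘ assoc W X (Y ⊗ Z).
Proof.
apply: assoc_epi; apply: assoc_mono.
rewrite -!compA assocK compm1 -pentagon !compA assocVK comp1m -tensm_compr.
by rewrite assocK tensm1 comp1m.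
Qed.

Lemma pentagonVM W X Y Z :
  assocV W X (Y ⊗ Z) ∘ (idm W ⊠ assoc X Y Z) ∘ assoc W (X ⊗ Y) Z
  = assoc (W ⊗ X) Y Z ∘ (assocV W X Y ⊠ idm Z).
Proof.
apply: assoc_mono.
rewrite !compA assocVK comp1m -pentagon -compA -tensm_compl assocVK tensm1.
by rewrite compm1.
Qed.

End Coherence.

Section Separable.

Variables (M : monoidal_category) (A : algebra M).

Definition square_lact : hom (A ⊗ (A ⊗ A)) (A ⊗ A) :=
  (amul A ⊠ idm A) ∘ assocV A A A.

Definition square_ract : hom ((A ⊗ A) ⊗ A) (A ⊗ A) :=
  (idm A ⊠ amul A) ∘ assoc A A A.

Lemma square_lactA :
  square_lact ∘ (amul A ⊠ idm (A ⊗ A))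
  = square_lact ∘ (idm A ⊠ square_lact) ∘ assoc A A (A ⊗ A).
Proof.
rewrite /square_lact -tensm1 -compA assocV_nat compA -tensm_compl amulA.
rewrite tensm_compl -compA pentagonV tensm_compl tensm_compr !compA.
by rewrite -(compA _ (assocV A A A)) assocV_nat !compA.
Qed.

Lemma square_lact1 : square_lact ∘ (aunit A ⊠ idm (A ⊗ A)) = lunit (A ⊗ A).
Proof.
rewrite /square_lact -tensm1 -compA assocV_nat compA -tensm_compl amul1m.
by rewrite -lunit_assoc -compA assocVK compm1.
Qed.

Lemma square_ractA :
  square_ract ∘ (square_ract ⊠ idm A)
  = square_ract ∘ (idm (A ⊗ A) ⊠ amul A) ∘ assoc (A ⊗ A) A A.
Proof.
rewrite /square_ract tensm_compl compA -(compA _ (assoc A A A)) assoc_nat.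
rewrite compA -tensm_compr amulA !tensm_compr -!compA.
rewrite (compA (idm A ⊠ assoc A A A)) pentagon -tensm1 !compA.
by rewrite -(compA _ (assoc A A A)) assoc_nat !compA.
Qed.

Lemma square_ract1 : square_ract ∘ (idm (A ⊗ A) ⊠ aunit A) = runit (A ⊗ A).
Proof.
rewrite /square_ract -tensm1 -compA assoc_nat compA -tensm_compr amulm1.
exact: runit_assoc.
Qed.

Lemma square_lractA :
  square_ract ∘ (square_lact ⊠ idm A)
  = square_lact ∘ (idm A ⊠ square_ract) ∘ assoc A (A ⊗ A) A.
Proof.
rewrite /square_ract /square_lact tensm_compl tensm_compr !compA.
rewrite -(compA _ (assoc A A A)) assoc_nat tensm1 compA.
rewrite -(compA _ (assocV A A A)) assocV_nat tensm1 compA.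
rewrite -!tensmM !comp1m !compm1 -!(compA (amul A ⊠ amul A)) -pentagonVM.
by rewrite !compA.
Qed.

Definition square_bimodule : bimodules A :=
  @Bimodule M A (A ⊗ A) square_lact square_ract
    square_lactA square_lact1 square_ractA square_ract1 square_lractA.

Lemma amul_lact : amul A ∘ square_lact = amul A ∘ (idm A ⊠ amul A).
Proof. by rewrite /square_lact compA amulA -compA assocVK compm1. Qed.

Lemma amul_ract : amul A ∘ square_ract = amul A ∘ (amul A ⊠ idm A).
Proof. by rewrite /square_ract compA amulA. Qed.

Definition amul_hom : hom square_bimodule (regular_bimodule A) :=
  @BimoduleHom M A square_bimodule (regular_bimodule A) (amul A)
    amul_lact amul_ract.

Definition separable : Prop := has_section amul_hom.

End Separable.

(* Main.v *)
(** For (a) => (b), let s be a bimodule section of the multiplication and let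
    e = s(1) = sum e1 ⊗ e2.  A morphism h : X -> Y of the base category is
    averaged to x |-> sum e1 h(e2 x), which is left linear, equals h when h is
    already left linear, is natural, and stays right linear if h was.  The
    right-hand average is the left-hand one in the reversed monoidal category;
    composing both gives the retraction of the forgetful functor on morphisms.
    For (b) => (c), the retraction turns a section t of f in the base category
    into the lift of g obtained from t ∘ g.  For (d) => (a), the multiplication
    is split in the base category by the unit, so lift the identity along it. *)
From Corelib Require Import ssreflect.
Require Import Defs.
Set Implicit Arguments.
Unset Strict Implicit.
Unset Printing Implicit Defensive.
Local Open Scope cat_scope.

(** * Rewriting inside right-nested composites *)

Lemma comp_reassoc (C : category) (V X Y Z : C) (g : hom Y Z) (f : hom X Y)
    (k : hom X Z) :
  g ∘ f = k -> forall v : hom V X, g ∘ (f ∘ v) = k ∘ v.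
Proof. by move=> E v; rewrite compA E. Qed.

Lemma tensm_exch (M : monoidal_category) (X X' Y Y' : M)
    (f : hom X X') (g : hom Y Y') :
  (f ⊠ idm Y') ∘ (idm X ⊠ g) = (idm X' ⊠ g) ∘ (f ⊠ idm Y).
Proof. by rewrite -!tensmM !comp1m !compm1. Qed.

Lemma assoc_nat_l (M : monoidal_category) (X X' Y Z : M) (f : hom X X') :
  assoc X' Y Z ∘ ((f ⊠ idm Y) ⊠ idm Z) = (f ⊠ idm (Y ⊗ Z)) ∘ assoc X Y Z.
Proof. by rewrite assoc_nat tensm1. Qed.

Lemma assoc_nat_r (M : monoidal_category) (X Y Z Z' : M) (f : hom Z Z') :
  assoc X Y Z' ∘ (idm (X ⊗ Y) ⊠ f) = (idm X ⊠ (idm Y ⊠ f)) ∘ assoc X Y Z.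
Proof. by rewrite -tensm1 assoc_nat. Qed.

(** One-sided modules let the same averaging serve for right actions, as left actions in the
    reversed category. *)
Record lmodule (M : monoidal_category) (A : algebra M) := LModule {
  lmob :> M;
  lmact : hom (A ⊗ lmob) lmob;
  lmactA : lmact ∘ (amul A ⊠ idm lmob)
    = lmact ∘ (idm A ⊠ lmact) ∘ assoc A A lmob;
  lmact1 : lmact ∘ (aunit A ⊠ idm lmob) = lunit lmob
}.

Definition left_linear (M : monoidal_category) (A : algebra M)
    (X Y : lmodule A) (h : hom X Y) : Prop :=
  h ∘ lmact X = lmact Y ∘ (idm A ⊠ h).

(** * Inserting the unit, [x |-> 1 ⊗ x] *)

Section UnitInsertion.

Variables (M : monoidal_category) (A : algebra M).

Definition insert_unit (X : M) : hom X (A ⊗ X) :=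
  (aunit A ⊠ idm X) ∘ lunitV X.

Lemma lunitV_nat (X Y : M) (f : hom X Y) :
  (idm munit ⊠ f) ∘ lunitV X = lunitV Y ∘ f.
Proof.
by rewrite -[LHS]comp1m -(lunitK Y) -!compA (compA (lunit Y)) lunit_nat -compA
  lunitVK compm1.
Qed.

Lemma insert_unit_nat (X Y : M) (f : hom X Y) :
  (idm A ⊠ f) ∘ insert_unit X = insert_unit Y ∘ f.
Proof.
by rewrite /insert_unit -compA -lunitV_nat !compA tensm_exch.
Qed.

Lemma lmact_insert_unit (X : lmodule A) : lmact X ∘ insert_unit X = idm X.
Proof. by rewrite /insert_unit compA lmact1 lunitVK. Qed.

Lemma assoc_insert_unit (X Y : M) :
  assoc A X Y ∘ (insert_unit X ⊠ idm Y) = insert_unit (X ⊗ Y).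
Proof.
rewrite /insert_unit tensm_compl compA assoc_nat_l -compA; f_equal.
rewrite -[LHS]comp1m -(lunitK (X ⊗ Y)) -compA (compA (lunit _)) lunit_assoc.
by rewrite -tensm_compl lunitVK tensm1 compm1.
Qed.

Lemma amul_insert_unit_l (X : M) :
  (amul A ⊠ idm X) ∘ (assocV A A X ∘ insert_unit (A ⊗ X)) = idm (A ⊗ X).
Proof.
rewrite -assoc_insert_unit (comp_reassoc (assocK _ _ _)) comp1m -tensm_compl.
by rewrite /insert_unit compA amul1m lunitVK tensm1.
Qed.

Lemma amul_insert_unit_r (X : M) :
  (amul A ⊠ idm X) ∘ (assocV A A X ∘ (idm A ⊠ insert_unit X)) = idm (A ⊗ X).
Proof.
rewrite /insert_unit tensm_compr (comp_reassoc (assocV_nat _ _ _)) -compA compA.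
rewrite -tensm_compl amulm1 -triangle -compA (comp_reassoc (assocVK _ _ _)).
by rewrite comp1m -tensm_compr lunitVK tensm1.
Qed.

(** [K(1 ⊗ ax) = K(1a ⊗ x) = K(a ⊗ x)]. *)
Lemma balanced_factor (X : lmodule A) (Z : M) (K : hom (A ⊗ X) Z) :
  K ∘ (amul A ⊠ idm X) = K ∘ ((idm A ⊠ lmact X) ∘ assoc A A X) ->
  K ∘ insert_unit X ∘ lmact X = K.
Proof.
move=> E; rewrite -compA -insert_unit_nat -[insert_unit _]comp1m.
rewrite -(assocVK A A X) -!compA (compA (idm A ⊠ lmact X)).
by rewrite (comp_reassoc (eq_sym E)) -compA amul_insert_unit_l compm1.
Qed.

(** [a K(1 ⊗ x) = K(a1 ⊗ x) = K(a ⊗ x)]. *)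
Lemma linear_extend (X : M) (Y : lmodule A) (K : hom (A ⊗ X) Y) :
  K ∘ (amul A ⊠ idm X) = lmact Y ∘ ((idm A ⊠ K) ∘ assoc A A X) ->
  lmact Y ∘ (idm A ⊠ (K ∘ insert_unit X)) = K.
Proof.
move=> E; rewrite tensm_compr -[idm A ⊠ insert_unit _]comp1m.
rewrite -(assocVK A A X) -!compA (compA (idm A ⊠ K)).
by rewrite (comp_reassoc (eq_sym E)) -compA amul_insert_unit_r compm1.
Qed.

End UnitInsertion.

(** * Averaging a morphism between left modules *)

Section LeftAverage.

Variables (M : monoidal_category) (A : algebra M) (s : hom A (A ⊗ A)).
Hypothesis s_lact : s ∘ amul A = (amul A ⊠ idm A) ∘ assocV A A A ∘ (idm A ⊠ s).
Hypothesis s_ract : s ∘ amul A = (idm A ⊠ amul A) ∘ assoc A A A ∘ (s ⊠ idm A).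
Hypothesis s_section : amul A ∘ s = idm A.

(** Written with elements: a ⊗ x |-> sum a e1 h(e2 x). *)
Definition avg_kernel (X Y : lmodule A) (h : hom X Y) : hom (A ⊗ X) Y :=
  lmact Y ∘ ((idm A ⊠ (h ∘ lmact X)) ∘ (assoc A A X ∘ (s ⊠ idm X))).

Definition left_avg (X Y : lmodule A) (h : hom X Y) : hom X Y :=
  avg_kernel h ∘ insert_unit A X.

(** Left linearity of [s], [s(ab) = a s(b)], pulls [a] out in front of the action on [Y]. *)
Lemma avg_kernel_linear (X Y : lmodule A) (h : hom X Y) :
  avg_kernel h ∘ (amul A ⊠ idm X)
  = lmact Y ∘ ((idm A ⊠ avg_kernel h) ∘ assoc A A X).
Proof.
rewrite /avg_kernel -!compA -tensm_compl s_lact !tensm_compl -!compA.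
rewrite (comp_reassoc (assoc_nat_l _ _ _)) -!compA.
rewrite (comp_reassoc (eq_sym (tensm_exch _ _))) -!compA.
rewrite (comp_reassoc (lmactA Y)) -!compA.
rewrite (comp_reassoc (assoc_nat_r _ _ _)) -!compA.
rewrite (comp_reassoc (eq_sym (pentagonVM _ _ _ _))) -!compA.
rewrite (comp_reassoc (assocVK _ _ _)) comp1m assoc_nat.
by rewrite !tensm_compr -!compA.
Qed.

(** Right linearity of [s], [s(ab) = s(a) b], lets [b] act on [x] before [h] is applied. *)
Lemma avg_kernel_balanced (X Y : lmodule A) (h : hom X Y) :
  avg_kernel h ∘ (amul A ⊠ idm X)
  = avg_kernel h ∘ ((idm A ⊠ lmact X) ∘ assoc A A X).
Proof.
rewrite /avg_kernel -!compA -tensm_compl s_ract !tensm_compl -!compA.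
rewrite (comp_reassoc (assoc_nat _ _ _)) -!compA.
rewrite (comp_reassoc (eq_sym (tensm_compr _ _ _))) -(compA h) lmactA.
rewrite (comp_reassoc (tensm_exch _ _)) -!compA.
rewrite (comp_reassoc (assoc_nat_r _ _ _)) -!compA -assoc_nat_l.
rewrite (comp_reassoc (eq_sym (pentagon _ _ _ _))).
by rewrite !tensm_compr -!compA.
Qed.

(** Both sides equal [avg_kernel h]: one because it is balanced, the other because it is linear. *)
Lemma left_avg_linear (X Y : lmodule A) (h : hom X Y) :
  left_linear (left_avg h).
Proof.
rewrite /left_linear (balanced_factor (avg_kernel_balanced h)).
by rewrite (linear_extend (avg_kernel_linear h)).
Qed.

(** [sum e1 h(e2 x) = (sum e1 e2) h(x) = h(x)], since [s] is a section of the multiplication. *)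
Lemma left_avg_id (X Y : lmodule A) (h : hom X Y) :
  left_linear h -> left_avg h = h.
Proof.
move=> hL; rewrite /left_avg /avg_kernel hL tensm_compr -!compA.
rewrite (comp_reassoc (eq_sym (assoc_nat_r _ _ _))) -!compA.
rewrite !compA -lmactA -!compA (comp_reassoc (tensm_exch _ _)) -!compA.
rewrite (comp_reassoc (eq_sym (tensm_compl _ _ _))) s_section tensm1 comp1m.
by rewrite insert_unit_nat compA lmact_insert_unit comp1m.
Qed.

Lemma left_avg_nat (X X' Y Y' : lmodule A)
    (f : hom X' X) (g : hom Y Y') (h : hom X Y) :
  left_linear f -> left_linear g ->
  left_avg (g ∘ h ∘ f) = g ∘ left_avg h ∘ f.
Proof.
move=> fL gL.
(* [e2] passes through [f] and [e1] through [g], both being linear. *)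
have E : avg_kernel (g ∘ h ∘ f) = g ∘ (avg_kernel h ∘ (idm A ⊠ f)).
  rewrite /avg_kernel -!compA fL !tensm_compr (compA g) gL -!compA.
  rewrite (comp_reassoc (eq_sym (assoc_nat_r _ _ _))) -!compA.
  by rewrite tensm_exch.
rewrite /left_avg E -(compA g) -(compA (avg_kernel h)) insert_unit_nat.
by rewrite !compA.
Qed.

Lemma left_avg_right_linear (B : M) (X Y : lmodule A)
    (rX : hom (X ⊗ B) X) (rY : hom (Y ⊗ B) Y) (h : hom X Y) :
  rX ∘ (lmact X ⊠ idm B) = lmact X ∘ (idm A ⊠ rX) ∘ assoc A X B ->
  rY ∘ (lmact Y ⊠ idm B) = lmact Y ∘ (idm A ⊠ rY) ∘ assoc A Y B ->
  h ∘ rX = rY ∘ (h ⊠ idm B) ->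
  left_avg h ∘ rX = rY ∘ (left_avg h ⊠ idm B).
Proof.
move=> cX cY hR.
(* On kernels: [K(a ⊗ xb) = K(a ⊗ x) b], as the right action commutes with [e1], with [e2] and with
   [h]. *)
have E : avg_kernel h ∘ ((idm A ⊠ rX) ∘ assoc A X B)
       = rY ∘ (avg_kernel h ⊠ idm B).
  rewrite /avg_kernel !tensm_compl -!compA (comp_reassoc cY) -!compA.
  rewrite (comp_reassoc (assoc_nat _ _ _)) -!compA.
  rewrite (comp_reassoc (eq_sym (tensm_compr _ _ _))) tensm_compl.
  rewrite (comp_reassoc (eq_sym hR)) -compA cX.
  rewrite (comp_reassoc (tensm_exch _ _)) -!compA.
  rewrite (comp_reassoc (assoc_nat_r _ _ _)) -!compA -assoc_nat_l.
  rewrite (comp_reassoc (eq_sym (pentagon _ _ _ _))).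
  by rewrite !tensm_compr -!compA.
rewrite /left_avg -compA -insert_unit_nat -assoc_insert_unit.
by rewrite tensm_compl (compA (idm A ⊠ _)) (comp_reassoc E) -compA.
Qed.

End LeftAverage.

(** * The reversed monoidal category, where right modules become left modules *)

Section Reverse.

Variable M : monoidal_category.

Lemma pentagon_inv (W X Y Z : M) :
  (assocV W X Y ⊠ idm Z) ∘ assocV W (X ⊗ Y) Z ∘ (idm W ⊠ assocV X Y Z)
  = assocV (W ⊗ X) Y Z ∘ assocV W X (Y ⊗ Z).
Proof.
apply: assoc_epi; rewrite -!compA assocK compm1 (compA (assocV W _ _)).
rewrite -pentagonV compA -tensm_compl.
by rewrite assocK tensm1 comp1m.
Qed.

Lemma triangle_inv (X Y : M) :
  (runit X ⊠ idm Y) ∘ assocV X munit Y = idm X ⊠ lunit Y.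
Proof. by rewrite -triangle -compA assocVK compm1. Qed.

(** Swapping the factors exchanges the associator with its inverse and the left unit with the right
    one. *)
Definition rev_monoidal : monoidal_category :=
  @MonoidalCategory M
    (fun X Y => Y ⊗ X)
    (fun X X' Y Y' f g => g ⊠ f)
    (fun X Y => tensm1 Y X)
    (fun X X' X'' Y Y' Y'' f' f g' g => tensmM g' g f' f)
    munit
    (fun X Y Z => assocV Z Y X)
    (fun X Y Z => assoc Z Y X)
    (fun X Y Z => assocVK Z Y X)
    (fun X Y Z => assocK Z Y X)
    (fun X X' Y Y' Z Z' f g h => assocV_nat h g f)
    (@runit M) (@runitV M) (@runitK M) (@runitVK M) (@runit_nat M)
    (@lunit M) (@lunitV M) (@lunitK M) (@lunitVK M) (@lunit_nat M)
    (fun X Y => triangle_inv Y X)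
    (fun W X Y Z => pentagon_inv Z Y X W).

Variable A : algebra M.

Lemma rev_amulA :
  amul A ∘ (idm A ⊠ amul A) = amul A ∘ (amul A ⊠ idm A) ∘ assocV A A A.
Proof. by rewrite amulA -compA assocVK compm1. Qed.

Definition rev_algebra : algebra rev_monoidal :=
  @Algebra rev_monoidal A (amul A) (aunit A) rev_amulA (amulm1 A) (amul1m A).

Definition left_module (X : bimodule A) : lmodule A :=
  LModule (lactA X) (lact1 X).

Lemma rev_ractA (X : bimodule A) :
  ract X ∘ (idm X ⊠ amul A) = ract X ∘ (ract X ⊠ idm A) ∘ assocV X A A.
Proof. by rewrite ractA -compA assocVK compm1. Qed.

Definition right_module (X : bimodule A) : lmodule rev_algebra :=
  @LModule rev_monoidal rev_algebra (bob X) (ract X) (rev_ractA X) (ract1 X).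

End Reverse.

(** * The implications between the four assertions *)

Section Equivalences.

Variables (M : monoidal_category) (A : algebra M).

Lemma separable_forgetful : separable A -> separable_functor (forgetful A).
Proof.
case=> -[s sl sr] /(f_equal (@bmap M A _ _)) /= mK.
rewrite /= /square_lact in sl; rewrite /= /square_ract in sr.
pose L (X Y : bimodule A) (h : hom (bob X) (bob Y)) : hom (bob X) (bob Y) :=
  @left_avg M A s (left_module X) (left_module Y) h.
pose R (X Y : bimodule A) (h : hom (bob X) (bob Y)) : hom (bob X) (bob Y) :=
  @left_avg (rev_monoidal M) (rev_algebra A) s (right_module X) (right_module Y) h.
have Ll X Y (h : hom (bob X) (bob Y)) :
    L X Y h ∘ lact X = lact Y ∘ (idm A ⊠ L X Y h).
  exact: (@left_avg_linear M A s sl sr (left_module X) (left_module Y) h).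
have Rr X Y (h : hom (bob X) (bob Y)) :
    R X Y h ∘ ract X = ract Y ∘ (R X Y h ⊠ idm A).
  (* Reversal swaps the two linearity conditions on [s]. *)
  exact: (@left_avg_linear (rev_monoidal M) (rev_algebra A) s sr sl
            (right_module X) (right_module Y) h).
have Lr X Y (h : hom (bob X) (bob Y)) : h ∘ ract X = ract Y ∘ (h ⊠ idm A) ->
    L X Y h ∘ ract X = ract Y ∘ (L X Y h ⊠ idm A).
  exact: (@left_avg_right_linear M A s A (left_module X) (left_module Y)
            (ract X) (ract Y) h (lractA X) (lractA Y)).
(* [R] first makes [h] right linear; [L] then makes it left linear and preserves what [R]
   achieved. *)
exists (fun X Y h => BimoduleHom (Ll X Y (R X Y h)) (Lr X Y _ (Rr X Y h))).
split=> [X X' Y Y' f g h | X Y f]; apply: bimodule_hom_eq => /=.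
- transitivity (L X' Y' (bmap g ∘ R X Y h ∘ bmap f)).
    congr L.
    exact: (@left_avg_nat (rev_monoidal M) (rev_algebra A) s
              (right_module X) (right_module X') (right_module Y)
              (right_module Y') f g h (bmap_ract f) (bmap_ract g)).
  exact: (@left_avg_nat M A s (left_module X) (left_module X')
            (left_module Y) (left_module Y') f g (R X Y h)
            (bmap_lact f) (bmap_lact g)).
- transitivity (L X Y (bmap f)).
    congr L.
    exact: (@left_avg_id (rev_monoidal M) (rev_algebra A) s mK
              (right_module X) (right_module Y) f (bmap_ract f)).
  exact: (@left_avg_id M A s mK (left_module X) (left_module Y) f (bmap_lact f)).
Qed.

(** With retraction [S], naturality gives [f ∘ S(t ∘ U g) = S(U f ∘ t ∘ U g) = S(U g) = g]. *)
Lemma separable_functor_projective (B C : category) (U : functor B C) (P : B) :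
  separable_functor U ->
  projective (fun X Y (f : hom X Y) => has_section (fmap U f)) P.
Proof.
case=> S [S_nat S_id] X Y f [t ft] g; exists (S P X (t ∘ fmap U g)).
have := S_nat _ _ _ _ (idm P) f (t ∘ fmap U g).
by rewrite compm1 fmap1 compm1 compA ft comp1m S_id.
Qed.

Lemma amul_split_in_base : split_in_base (amul_hom A).
Proof.
exists (insert_unit A A).
by rewrite /= /insert_unit compA amul1m lunitVK.
Qed.

Lemma projective_separable :
  projective (@split_in_base M A) (regular_bimodule A) -> separable A.
Proof. by move=> pA; apply: (pA _ _ _ amul_split_in_base). Qed.

End Equivalences.

Theorem proposition2p6 (M : monoidal_category) (strictM : strict M) (A : algebra M) :
  (separable A <-> separable_functor (forgetful A))
  /\ (separable A <-> forall P : bimodules A, projective (@split_in_base M A) P)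
  /\ (separable A <-> projective (@split_in_base M A) (regular_bimodule A)).
Proof.
have bc : separable_functor (forgetful A) ->
    forall P : bimodules A, projective (@split_in_base M A) P.
  by move=> sU P; apply: separable_functor_projective.
have ab := @separable_forgetful M A; have da := @projective_separable M A.
(* The cycle closes with (c) => (d), the instance of (c) at the regular bimodule. *)
by split; [|split]; split=> H; auto.
Qed.
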